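(* Let $X$ be a regular $T_1$ topological space. The following statements are equivalent. (1) $(CL(X),\tau_F)$ is a $D_1$-space. (2) $(\mathcal{K}(X),\tau_F)$ is a $D_1$-space. (3) $(\mathcal{F}_n(X),\tau_F)$ is a $D_1$-space for some $n\geq 2$. (4) $X$ is compact and metrizable.
   Context: $CL(X)$ is the set of all nonempty closed subsets of $X$; $\mathcal{K}(X)$ is the set of all nonempty compact subsets of $X$; $\mathcal{F}_n(X)=\{A\subset X: A\neq\emptyset, |A|\leq n\}$. The Fell topology $\tau_F$ on $CL(X)$ is generated by the subbase consisting of the sets $U^-=\{H\in CL(X): H\cap U\neq\emptyset\}$ for $U$ nonempty open in $X$, and the sets $(K^c)^+=\{H\in CL(X): H\subset X\setminus K\}$ for $K$ compact in $X$, $K\neq X$. On $\mathcal{K}(X)$ and $\mathcal{F}_n(X)$, $\tau_F$ denotes the subspace topology. A space $Y$ is a $D_1$-space if every closed subset $A$ of $Y$ has a countable local base, i.e. there is a countable family of open sets containing $A$ such that every open set containing $A$ contains a member of the family. *)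

(* Defs.v *)
From HB Require Import structures.
From mathcomp Require Import all_boot all_order all_algebra.
From mathcomp Require Import all_classical all_reals all_analysis.

Set Implicit Arguments.
Unset Strict Implicit.
Unset Printing Implicit Defensive.

Import Order.TTheory GRing.Theory Num.Theory.

Local Open Scope classical_set_scope.
Local Open Scope ring_scope.

Definition CL (X : topologicalType) : Type :=
  set_type [set A : set X | closed A /\ A !=set0].

Definition cl_set (X : topologicalType) (H : CL X) : set X := set_val H.

Section Fell_topology.
Variable X : topologicalType.

Definition hit (U : set X) : set (CL X) := [set H | cl_set H `&` U !=set0].

Definition miss (K : set X) : set (CL X) := [set H | cl_set H `<=` ~` K].

Definition Fell_subbase : set (set (CL X)) :=
  [set hit U | U in [set U : set X | open U /\ U !=set0]] `|`
  [set miss K | K in [set K : set X | compact K /\ K <> [set: X]]].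

HB.instance Definition _ := Choice.on (CL X).
HB.instance Definition _ :=
  isSubBaseTopological.Build (CL X) Fell_subbase id.

End Fell_topology.

(* For T1 spaces finite sets are closed, and for Hausdorff (in particular
   regular T1) spaces compact sets are closed, so nothing is lost by carving
   both families out of CL X. As types they carry the subspace topology,
   i.e. the initial topology of the inclusion into CL X. *)
Definition Kfam (X : topologicalType) : set (CL X) :=
  [set H | compact (cl_set H)].

Definition Ffam (X : topologicalType) (n : nat) : set (CL X) :=
  [set H | cl_set H #<= `I_n]%card.

Definition D1_space (Y : topologicalType) : Prop :=
  forall A : set Y, closed A ->
    exists B : set (set Y),
      [/\ countable B,
          (forall U, B U -> open U /\ A `<=` U) &
          (forall V, open V -> A `<=` V -> exists2 U, B U & U `<=` V)].

Definition is_metric (R : realType) (T : Type) (d : T -> T -> R) : Prop :=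
  [/\ (forall x y, 0 <= d x y),
      (forall x y, d x y = 0 <-> x = y),
      (forall x y, d x y = d y x) &
      (forall x y z, d x z <= d x y + d y z)].

Definition metrizable (R : realType) (X : topologicalType) : Prop :=
  exists2 d : X -> X -> R, is_metric d &
    forall U : set X, open U <->
      (forall x, U x -> exists2 e, 0 < e & [set y | d x y < e] `<=` U).

(* Main.v *)
Require Import Defs.
From mathcomp Require Import all_boot finmap all_order all_algebra.
From mathcomp Require Import all_classical all_reals all_analysis.

Import Order.TTheory GRing.Theory Num.Theory numFieldNormedType.Exports.

Local Open Scope classical_set_scope.

(** Each of the first three conditions says that some family F of nonempty
    closed sets, containing every pair {x, y}, is a D_1-space for the Fell
    topology; this alone implies that X is compact and metrizable.  The space X
    is Hausdorff, being regular and T_1.  The two facts used about pairs are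
    that, if V is an open neighborhood of {x}, then {x, y} is in V for all y
    outside some compact set [pair_CL_cocompact], and {y, z} is in V for all y
    and z near x [pair_CL_near].

    X is countably compact [D1_within_countably_compact].  Otherwise there are
    an exhaustion of X by open sets H_0, H_1, ... and points x_j such that x_j
    is in H_m exactly when j < m.  The set A of all the {x_n} is closed; let
    V_n be a countable base of neighborhoods of A.  A compact set lies in some
    H_k, so that V_n contains {x_n, x_j} for some j = j_n > n.  The sets H that
    meet H_{n+1} and avoid x_0, ..., x_{n-1} and x_{j_n}, for some n, form an
    open set that contains A but none of the chosen pairs {x_n, x_{j_n}}, hence
    no V_n: a contradiction.

    X is compact [diagonal_compact].  The singletons form a closed set, and its
    countable base V_n satisfies: if {x, y} is in every V_n then x = y
    [D1_within_diagonal].  Fix x, and let K_n be a compact set such that {x, y}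
    is in V_n for all y outside K_n.  Then X is the union of {x} and of the
    K_n, so it is sigma-compact, and it is countably compact.

    X is metrizable.  For each n, compactness gives a finite cover of X by open
    sets U such that {y, z} is in V_n for all y and z in the closure of U.  The
    finite intersections of members of these covers form a countable base
    [diagonal_second_countable], and Urysohn's lemma provides a countable
    family of continuous functions that defines a metric
    [separating_family_metrizable].

    Conversely, if X is compact and metrizable then CL X is compact and second
    countable [CL_compact, CL_second_countable], and any such space is a
    D_1-space, because finite unions of basic open sets form a base at every
    closed set [compact_second_countable_D1].  The compact sets, which are then
    all the closed sets, and the sets of at most n points form closed subspaces
    of CL X, and a closed subspace of a D_1-space is a D_1-space. *)

(** * Compactness and covers *)

(** Compactness in terms of ideals: a property of sets that is stable under
    finite unions and holds locally at each point of a compact set A holds for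
    some set that contains A. *)
Lemma compact_ideal_cover {X : topologicalType} {A : set X}
    (P : set (set X)) :
  compact A -> P set0 -> (forall U V, P U -> P V -> P (U `|` V)) ->
  (forall x, A x -> exists2 U, P U & nbhs x U) ->
  exists2 U, P U & A `<=` U.
Proof.
move=> cA P0 PU Acov; apply: contrapT => nP.
pose F := filter_from P (fun U => A `\` U).
have FF : ProperFilter F.
  apply: filter_from_proper; last first.
    move=> U PU'; apply: contrapT => AU; apply: nP; exists U => // x Ax.
    by apply: contrapT => Ux; apply: AU; exists x.
  apply: filter_from_filter; first by exists set0.
  move=> U V PU' PV; exists (U `|` V); first exact: PU.
  by rewrite setDUr.
have [|x [Ax Fx]] := cA F FF; first by exists set0 => // x [].
have [U PU' xU] := Acov x Ax.
have [|y [[_ nUy] Uy]] := Fx (A `\` U) U _ xU; first by exists U.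
exact: nUy.
Qed.

Lemma compact_fset_cover {X : topologicalType} {A : set X} (B : set (set X)) :
  compact A -> (forall x, A x -> exists2 U, B U & nbhs x U) ->
  exists2 D : {fset set X}, {subset D <= B} &
    A `<=` \bigcup_(U in [set` D]) U.
Proof.
move=> cA AB.
have [|||U [D DB UD] AU] := compact_ideal_cover
    [set U | exists2 D : {fset set X}, {subset D <= B} &
       U `<=` \bigcup_(U in [set` D]) U] cA.
- by exists fset0.
- move=> U V [D DB UD] [E EB VE]; exists (D `|` E)%fset.
    by move=> W; rewrite inE => /orP[/DB|/EB].
  by move=> x [/UD|/VE] [W /= WD Wx]; exists W => //=; rewrite inE WD ?orbT.
- move=> x /AB[U BU xU]; exists U => //; exists [fset U]%fset.
    by move=> V; rewrite inE => /eqP ->; exact/mem_set.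
  by move=> y Uy; exists U => //=; rewrite inE.
- by exists D => // x /AU /UD.
Qed.

(** Countable compactness, for increasing sequences of open sets; replacing a
    countable open cover by its finite partial unions shows that this is the
    same as having finite subcovers of all countable open covers. *)
Definition countably_compact_space (X : topologicalType) :=
  forall G : nat -> set X, (forall n, open (G n)) ->
    (forall n, G n `<=` G n.+1) -> \bigcup_n G n = setT ->
    exists n, G n = setT.

(** A filter without cluster point would assign to each K n an open
    neighborhood with complement in the filter; the partial unions of these
    open sets would cover X without any of them being X. *)
Lemma sigma_countably_compact {X : topologicalType} {K : nat -> set X} :
  (forall n, compact (K n)) -> \bigcup_n K n = setT ->
  countably_compact_space X -> compact [set: X].
Proof.
move=> cK KT cX F FF _; apply: contrapT => nF.
have [|G GP] := @choice nat (set X)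
    (fun n U => [/\ open U, F (~` U) & K n `<=` U]).
  move=> n.
  have [|||U [oU FU] KU] := compact_ideal_cover
      [set U | open U /\ F (~` U)] (cK n); last by exists U.
  - by rewrite /= setC0; split; [exact: open0|exact: filterT].
  - move=> U V [oU FU] [oV FV]; rewrite /= setCU; split; first exact: openU.
    exact: filterI.
  - move=> x _; have : ~ cluster F x by move=> Fx; apply: nF; exists x.
    move=> /existsNP[A /existsNP[B /not_implyP[FA /not_implyP[xB AB]]]].
    exists (interior B); last exact: nbhs_interior.
    split; first exact: open_interior.
    apply: filterS FA => y Ay /interior_subset By; apply: AB.
    by exists y.
pose H := fix H n := if n is m.+1 then H m `|` G m.+1 else G 0.
have [|||n HT] := cX H.
- by elim=> [|n oH] /=; [have [] := GP 0|apply: openU => //; have [] := GP n.+1].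
- by move=> n; exact: subsetUl.
- rewrite -subTset -KT => x [n _ Kx]; exists n => //.
  have [_ _ KG] := GP n.
  by case: n Kx KG => [|n] Kx KG; [|right]; exact: KG.
have : F (~` H n).
  elim: n {HT} => [|n FH] /=; first by have [] := GP 0.
  by rewrite setCU; apply: filterI => //; have [] := GP n.+1.
by rewrite HT setCT; exact: filter_not_empty.
Qed.

(** The failure of countable compactness, in a normal form: after passing to a
    subsequence, each stage of the exhaustion gains a new point x j. *)
Lemma exhaustion_seq {X : topologicalType} (G : nat -> set X) :
  (forall n, open (G n)) -> (forall n, G n `<=` G n.+1) ->
  \bigcup_n G n = setT -> (forall n, G n <> setT) ->
  exists (H : nat -> set X) (x : nat -> X),
    [/\ forall n, open (H n), forall m n, (m <= n)%N -> H m `<=` H n,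
        \bigcup_n H n = setT & forall m j, H m (x j) <-> (j < m)%N].
Proof.
move=> oG GS GT nG.
have Gle m n : (m <= n)%N -> G m `<=` G n.
  move/subnK <-; elim: (n - m)%N => [//|i IH].
  exact: subset_trans IH (GS _).
have [h hP] : {h : nat -> X * nat &
    forall n, ~ G n (h n).1 /\ G (h n).2 (h n).1}.
  apply: (@choice _ _ (fun n p => ~ G n p.1 /\ G p.2 p.1)) => n.
  have /existsNP[x nGx] : ~ forall x, G n x.
    by move=> GnT; apply: (nG n); rewrite -subTset => x _.
  by have [m _ Gm] : (\bigcup_n G n) x by [rewrite GT]; exists (x, m).
(* Some point outside G (k n) is in G (k n.+1). *)
pose k := fix k n := if n is m.+1 then (h (k m)).2 else 0%N.
have kS n : (k n < k n.+1)%N.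
  rewrite ltnNge; apply/negP => /Gle; have [nG' G'] := hP (k n).
  by move=> /(_ _ G').
have kle m n : (m <= n)%N -> (k m <= k n)%N.
  apply: (@homo_leq _ _ leq leqnn) => [? ? ?|i]; first exact: leq_trans.
  exact: ltnW.
have kge n : (n <= k n)%N by elim: n => // n IH; exact: leq_ltn_trans (kS n).
exists (G \o k), (fun n => (h (k n)).1); split => /= [n|m n mn||m j].
- exact: oG.
- exact/Gle/kle.
- rewrite -subTset -GT => x [n _ Gx]; exists n => //=.
  exact: Gle (kge n) _ Gx.
- have [nG' G'] := hP (k j); split=> [Gm|jm].
    by rewrite ltnNge; apply/negP => mj; apply: nG'; exact: Gle (kle _ _ mj) _ Gm.
  exact: (Gle (k j.+1) _ (kle _ _ jm)).
Qed.

Lemma compact_sub_exhaustion {X : topologicalType} (H : nat -> set X)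
    (K : set X) :
  (forall n, open (H n)) -> (forall m n, (m <= n)%N -> H m `<=` H n) ->
  \bigcup_n H n = setT -> compact K -> exists n, K `<=` H n.
Proof.
move=> oH Hle HT cK.
have [|||U [n Un] KU] := compact_ideal_cover
    [set U | exists n, U `<=` H n] cK.
- by exists 0.
- move=> U V [m Um] [n Vn]; exists (maxn m n) => x [/Um|/Vn]; apply: Hle.
    exact: leq_maxl.
  exact: leq_maxr.
- move=> x _; have [n _ Hx] : (\bigcup_n H n) x by rewrite HT.
  by exists (H n); [exists n|exact: open_nbhs_nbhs].
- by exists n => x /KU /Un.
Qed.

Lemma regular_T1_hausdorff {X : topologicalType} :
  regular_space X -> accessible_space X -> hausdorff_space X.
Proof.
move=> rX T1 x y xy; apply/eqP/negP => /negP nxy.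
have : nbhs x (~` [set y]).
  apply: open_nbhs_nbhs; split; last exact/eqP.
  exact/closed_openC/accessible_closed_set1.
by move=> /rX[B xB /(_ y)]; apply => // C yC; exact: xy.
Qed.

(** * The Fell topology *)

Lemma Fell_subbase_open {X : topologicalType} (S : set (CL X)) :
  Fell_subbase S -> open S.
Proof.
move=> SS; exists [set S]; last by rewrite bigcup_set1.
by move=> _ ->; exact: finI_from1.
Qed.

Lemma open_hit {X : topologicalType} (U : set X) : open U -> open (hit U).
Proof.
move=> oU; have [->|/set0P U0] := eqVneq U set0.
  rewrite (_ : hit set0 = set0); first exact: open0.
  by rewrite -subset0 => H [x []].
by apply: Fell_subbase_open; left; exists U.
Qed.

Lemma open_miss {X : topologicalType} (K : set X) : compact K -> open (miss K).
Proof.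
move=> cK; have [->|/eqP KT] := eqVneq K setT.
  rewrite (_ : miss setT = set0); first exact: open0.
  rewrite -subset0 => H HT; have [_ [x Hx]] := set_valP H.
  exact: HT x Hx I.
by apply: Fell_subbase_open; right; exists K.
Qed.

(** Convergence in the Fell topology can be tested on the subbase; the side
    conditions of the subbase (nonempty U, proper K) are superfluous. *)
Lemma Fell_cvg {X : topologicalType} (F : set_system (CL X)) (H : CL X) :
  Filter F ->
  (forall U, open U -> hit U H -> F (hit U)) ->
  (forall K, compact K -> miss K H -> F (miss K)) ->
  F --> H.
Proof.
move=> FF FU FK A; rewrite /= nbhsE => -[B [[D' sD <-] [C D'C CH]] BA].
have [fs fsD CE] := sD _ D'C.
have : F C.
  rewrite -CE; apply: filter_bigI => S Sfs.
  have SH : S H by move: CH; rewrite -CE; apply.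
  have /set_mem[[U [oU _] SE]|[K [cK _] SE]] := fsD S Sfs.
    by rewrite -SE; apply: FU => //; rewrite SE.
  by rewrite -SE; apply: FK => //; rewrite SE.
by apply: filterS => x Cx; apply: BA; exists C.
Qed.

Lemma pair_mem_CL {X : topologicalType} (T1 : accessible_space X) (x y : X) :
  [set x; y] \in [set A : set X | closed A /\ A !=set0].
Proof.
apply/mem_set; split; last by exists x; left.
by apply: closedU; exact: accessible_closed_set1.
Qed.

(** The pair {x, y} as a point of CL X; singletons are the pairs {x, x}.  The
    T_1 axiom is an argument because it makes the pair closed. *)
Definition pair_CL {X : topologicalType} (T1 : accessible_space X) (x y : X) :
    CL X := SigSub (pair_mem_CL T1 x y).

Lemma pair_CLE {X : topologicalType} (T1 : accessible_space X) (x y : X) :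
  cl_set (pair_CL T1 x y) = [set x; y].
Proof. by []. Qed.

Lemma cl_set_inj {X : topologicalType} : injective (@cl_set X).
Proof. exact: val_inj. Qed.

(** {x, y} tends to {x} as y leaves every compact set. *)
Lemma pair_CL_cocompact {X : topologicalType} (T1 : accessible_space X)
    (x : X) (V : set (CL X)) : open V -> V (pair_CL T1 x x) ->
  exists2 K, compact K & forall y, ~ K y -> V (pair_CL T1 x y).
Proof.
move=> oV Vx.
pose F := filter_from compact (fun K : set X => pair_CL T1 x @` (~` K)).
have FF : Filter F.
  apply: filter_from_filter; first by exists set0; exact: compact0.
  move=> K L cK cL; exists (K `|` L); first exact: compactU.
  by move=> _ [y /not_orP[Ky Ly] <-]; split; exists y.
have [K cK KV] : F V.
  apply: (@Fell_cvg _ F (pair_CL T1 x x)); last exact: open_nbhs_nbhs.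
    move=> U oU [z [/= zx Uz]]; exists set0; first exact: compact0.
    move=> _ [y _ <-]; exists z; split => //; left.
    by move: zx; rewrite /cl_set /=; case.
  move=> K cK Kx; exists K => //.
  by move=> _ [y nKy <-] z [->|->] //; apply: Kx; left.
by exists K => // y Ky; apply: KV; exists y.
Qed.

(** {y, z} tends to {x} as y and z tend to x. *)
Lemma pair_CL_near {X : topologicalType} (T1 : accessible_space X)
    (x : X) (V : set (CL X)) : hausdorff_space X ->
  open V -> V (pair_CL T1 x x) ->
  exists2 U, nbhs x U & forall y z, U y -> U z -> V (pair_CL T1 y z).
Proof.
move=> hX oV Vx.
pose F := filter_from (nbhs x)
  (fun U : set X => [set pair_CL T1 y.1 y.2 | y in U `*` U]).
have FF : Filter F.
  apply: filter_from_filter; first by exists setT; exact: filterT.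
  move=> U W xU xW; exists (U `&` W); first exact: filterI.
  by move=> _ [y [[/= ? ?] [? ?]] <-]; split; exists y.
have [U xU UV] : F V.
  apply: (@Fell_cvg _ F (pair_CL T1 x x)); last exact: open_nbhs_nbhs.
    move=> U oU [z [/= zx Uz]]; exists U.
      by apply: open_nbhs_nbhs; split => //; case: zx => <-.
    by move=> _ [[y1 y2] [/= Uy1 Uy2] <-]; exists y1; split => //; left.
  move=> K cK Kx; exists (~` K).
    apply: open_nbhs_nbhs; split.
      by apply: closed_openC; exact: compact_closed.
    by apply: Kx; left.
  by move=> _ [[y1 y2] [/= Uy1 Uy2] <-] z [->|->].
by exists U => // y z Uy Uz; apply: UV; exists (y, z).
Qed.

Lemma card_le_IINP {T : choiceType} (A : set T) (n : nat) :
  ~ (A #<= `I_n)%card <->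
  exists2 D : {fset T}, #|` D|%fset = n.+1 & [set` D] `<=` A.
Proof.
split=> [An|[D Dn DA] An]; last first.
  have /card_eq_fsetP/card_eqPle[_ ID] := Dn.
  have : (`I_n.+1 #<= `I_n)%card.
    exact: card_le_trans ID (card_le_trans (subset_card_le DA) An).
  by rewrite card_le_II ltnn.
suff: forall k, (k <= n.+1)%N ->
    exists2 D : {fset T}, #|` D|%fset = k & [set` D] `<=` A by exact.
elim=> [_|k IH kn]; first by exists fset0 => // x; rewrite /= inE.
have [D Dk DA] := IH (ltnW kn).
have [x Ax xD] : exists2 x, A x & x \notin D.
  apply: contrapT => nx; apply: An.
  have AD : A `<=` [set` D].
    by move=> x Ax; apply: contrapT => /negP xD; apply: nx; exists x.
  apply: card_le_trans (subset_card_le AD) _.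
  have /card_eq_fsetP/card_eqPle[DI _] := Dk.
  by apply: card_le_trans DI _; rewrite card_le_II.
exists (x |` D)%fset; first by rewrite cardfsU1 xD Dk add1n.
by move=> y /=; rewrite !inE => /orP[/eqP->//|yD]; exact: DA.
Qed.

(** Finitely many points of a Hausdorff space have pairwise disjoint open
    neighborhoods. *)
Lemma hausdorff_disjoint_nbhs {X : topologicalType} (D : {fset X}) :
  hausdorff_space X -> exists U : X -> set X,
    [/\ forall x, open (U x), forall x, x \in D -> U x x &
        forall x y, x \in D -> y \in D -> U x `&` U y !=set0 -> x = y].
Proof.
rewrite open_hausdorff => hX.
have [W WP] : {W : X * X -> set X * set X & forall p, p.1 != p.2 ->
    [/\ open (W p).1, open (W p).2, (W p).1 p.1, (W p).2 p.2 &
        (W p).1 `&` (W p).2 = set0]}.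
  apply: (@choice _ _ (fun p W => p.1 != p.2 -> [/\ open W.1, open W.2,
     W.1 p.1, W.2 p.2 & W.1 `&` W.2 = set0])) => -[x y].
  have [->|xy] := eqVneq x y; first by exists (set0, set0) => /eqP [].
  have [[A B] /= [/set_mem Ax /set_mem By] [oA oB /eqP AB]] := hX x y xy.
  by exists (A, B).
pose V x := \bigcap_(y in [set` D])
  [set z | y != x -> (W (x, y)).1 z /\ (W (y, x)).2 z].
exists (fun x => interior (V x)); split => [x|x xD|x y xD yD].
- exact: open_interior.
- apply: filter_bigI => y yD; have [->|yx] := eqVneq y x.
    by apply: filterS filterT => z _ /eqP [].
  have [oW1 _ W1 _ _] := WP (x, y) (introN eqP (fun e => elimN eqP yx (esym e))).
  have [_ oW2 _ W2 _] := WP (y, x) yx.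
  suff : nbhs x ((W (x, y)).1 `&` (W (y, x)).2).
    by apply: filterS => z [? ?] _; split.
  by apply: filterI; apply: open_nbhs_nbhs.
- move=> [z [/interior_subset Vx /interior_subset Vy]].
  apply/eqP; apply/negP => /negP xy.
  have [_ _ _ _ W0] := WP (x, y) xy.
  have [||Wx _] := Vx y; [by []|by rewrite eq_sym|].
  have [||_ Wy] := Vy x; [by []|by []|].
  by have : set0 z by rewrite -W0; split.
Qed.

(** A set with n + 1 points meets n + 1 disjoint open sets, and so do the sets
    close to it. *)
Lemma Ffam_closed {X : topologicalType} (n : nat) :
  hausdorff_space X -> closed (@Ffam X n).
Proof.
move=> hX; rewrite -openC openE => H /card_le_IINP[D Dn DH].
have [U [oU Uxx Ux]] := hausdorff_disjoint_nbhs D hX.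
suff : nbhs H (\bigcap_(x in [set` D]) hit (U x)).
  apply: filterS => H' H'U; apply/card_le_IINP.
  have [g gP] : {g : X -> X & forall x, x \in D -> (cl_set H' `&` U x) (g x)}.
    apply: (@choice _ _ (fun x y => x \in D -> (cl_set H' `&` U x) y)) => x.
    have [xD|_] := boolP (x \in D); last by exists x.
    by have [y yU] := H'U x xD; exists y.
  exists (g @` D)%fset.
    rewrite card_in_imfset // => x y xD yD gxy; apply: Ux => //.
    by exists (g x); split; [have [] := gP x xD|rewrite gxy; have [] := gP y yD].
  by move=> y /= /imfsetP[x /= xD ->]; have [] := gP x xD.
apply: filter_bigI => x xD; apply: open_nbhs_nbhs; split; first exact: open_hit.
by exists x; split; [exact: DH|exact: Uxx].
Qed.

Lemma Ffam1P {X : topologicalType} (T1 : accessible_space X) (H : CL X) :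
  Ffam 1 H <-> exists x, H = pair_CL T1 x x.
Proof.
split=> [H1|[x ->]].
  have [_ [x Hx]] := set_valP H; exists x; apply: cl_set_inj.
  rewrite pair_CLE setUid eqEsubset; split=> [y Hy|y ->//].
  apply: contrapT => yx; move: H1; apply/card_le_IINP.
  exists [fset x; y]%fset; last first.
    by move=> z /=; rewrite !inE => /orP[/eqP->|/eqP->].
  by rewrite cardfs2; have [xy|] := eqVneq x y => //; case: yx; rewrite xy.
rewrite /Ffam /= pair_CLE setUid.
by have /card_eqPle[] := @card_set1 _ x.
Qed.

(** * Countable bases at closed sets *)

Lemma D1_space_seq {Y : topologicalType} : D1_space Y ->
  forall A : set Y, closed A -> exists V : nat -> set Y,
    [/\ forall n, open (V n), forall n, A `<=` V n &
        forall W, open W -> A `<=` W -> exists n, V n `<=` W].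
Proof.
move=> D1Y A /D1Y[B [/pfcard_geP[B0|[f]] BA AB]].
  by have [//|U] := AB setT openT; rewrite B0.
have fB n : B (f n) by exact: funS.
exists f; split=> [n|n|W oW /(AB _ oW)[U BU UW]].
- by have [] := BA (f n) (fB n).
- by have [] := BA (f n) (fB n).
- by have [n _ fn] := @surj _ _ _ _ f U BU; exists n; rewrite fn.
Qed.

(** The property of being a D_1-space for the subspace F of Y, expressed with
    closed and open sets of Y, and with the countable base given as a
    sequence. *)
Definition D1_within {Y : topologicalType} (F : set Y) :=
  forall A : set Y, closed A -> exists V : nat -> set Y,
    [/\ forall n, open (V n), forall n, A `&` F `<=` V n &
        forall W, open W -> A `&` F `<=` W -> exists n, V n `&` F `<=` W].

Lemma D1_space_withinT {Y : topologicalType} :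
  D1_space Y -> D1_within [set: Y].
Proof.
move=> /D1_space_seq D1Y A /D1Y[V [oV AV VW]].
exists V; split=> // [n|W oW]; first by rewrite setIT.
by rewrite setIT => /(VW _ oW)[n Vn]; exists n; rewrite setIT.
Qed.

Lemma D1_space_within {Y : topologicalType} (F : set Y) :
  D1_space (set_type F) -> D1_within F.
Proof.
move=> /D1_space_seq D1F A cA.
have [|V [oV AV VW]] := D1F (set_val @^-1` A).
  apply: preimage_closed => // x _; exact: initial_continuous.
have [U UP] : {U : nat -> set Y &
    forall n, open (U n) /\ set_val @^-1` U n = V n}.
  by apply: (@choice _ _ (fun n U => open U /\ set_val @^-1` U = V n)) => n;
    have [U oU UV] := oV n; exists U.
exists U; split=> [n|n y [Ay Fy]|W oW AFW].
- by have [] := UP n.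
- have [_ UV] := UP n.
  suff : V n (SigSub (mem_set Fy)) by rewrite -UV.
  exact: AV.
- have [|z Az|n Vn] := VW (set_val @^-1` W); first by exists W.
    by apply: AFW; split => //; exact: set_valP.
  exists n => y [Uy Fy]; have [_ UV] := UP n.
  by apply: (Vn (SigSub (mem_set Fy))); rewrite -UV.
Qed.

Lemma D1_space_closed {Y : topologicalType} (F : set Y) :
  closed F -> D1_space Y -> D1_space (set_type F).
Proof.
move=> cF D1Y A cA.
have [U oU UA] : open (~` A) by exact: closed_openC.
have [B [cB BA AB]] := D1Y (F `&` ~` U) (closedI cF (open_closedC oU)).
exists [set set_val @^-1` V | V in B]; split.
- exact: card_le_trans (card_image_le _ _) cB.
- move=> _ [V BV <-]; have [oV FUV] := BA V BV; split; first by exists V.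
  move=> z Az; apply: FUV; split; first exact: set_valP.
  by move=> Uz; have : (~` A) z by rewrite -UA.
- move=> _ [W oW <-] AW.
  have [||V BV VW] := AB (W `|` ~` F).
  + by apply: openU => //; exact: closed_openC.
  + move=> y [Fy nUy]; left; apply: (AW (SigSub (mem_set Fy))).
    apply: contrapT => nA; apply: nUy.
    by have : (~` A) (SigSub (mem_set Fy)) by []; rewrite -UA.
  + exists (set_val @^-1` V); first by exists V.
    by move=> z /VW [//|]; case; exact: set_valP.
Qed.

(** * From a countable base at closed sets to compactness *)

Lemma D1_within_countably_compact {X : topologicalType}
    (T1 : accessible_space X) (F : set (CL X)) :
  hausdorff_space X -> (forall x y, F (pair_CL T1 x y)) -> D1_within F ->
  countably_compact_space X.
Proof.
move=> hX Fpair D1F G oG GS GT; apply: contrapT => /forallNP nG.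
have [H [x [oH Hle HT Hx]]] := exhaustion_seq G oG GS GT nG.
have cfin n : compact (x @` `I_n) by exact/finite_compact/finite_image.
(* The range of x is closed: only finitely many x j lie in H k. *)
have oD : open (~` range x).
  rewrite openE => p np; have [k _ Hp] : (\bigcup_n H n) p by rewrite HT.
  have : nbhs p (H k `&` ~` (x @` `I_k)).
    apply: open_nbhs_nbhs; split.
      by apply: openI => //; apply: closed_openC; exact: compact_closed.
    by split=> // -[i _ xi]; apply: np; exists i.
  apply: filterS => y [Hy ny] [i _ xi]; apply: ny; exists i => //=.
  by apply/Hx; rewrite xi.
(* The set of the singletons {x n}. *)
have [|V [oV AV VW]] := D1F (Ffam 1 `&` ~` hit (~` range x)).
  by apply: closedI; [exact: Ffam_closed|exact/open_closedC/open_hit].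
have sAP p : (Ffam 1 `&` ~` hit (~` range x)) p <->
    exists n, p = pair_CL T1 (x n) (x n).
  split=> [[/(Ffam1P T1)[y ->]] nh|[n ->]].
    have [n _ <-] : range x y.
      by apply: contrapT => ny; apply: nh; exists y; split => //; left.
    by exists n.
  split; first by apply/(Ffam1P T1); exists (x n).
  by move=> [y [[|] /= -> ny]]; apply: ny; exists n.
have [j jP] : {j : nat -> nat & forall n,
    (n < j n)%N /\ V n (pair_CL T1 (x n) (x (j n)))}.
  apply: (@choice _ _ (fun n j =>
    (n < j)%N /\ V n (pair_CL T1 (x n) (x j)))) => n.
  have [|K cK KV] := pair_CL_cocompact T1 (x n) (V n) (oV n).
    by apply: AV; split => //; apply/sAP; exists n.
  have [k KH] := compact_sub_exhaustion H K oH Hle HT cK.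
  exists (maxn n.+1 k); split; first exact: leq_maxl.
  by apply: KV => /KH /Hx; rewrite ltnNge leq_maxr.
(* The n-th set contains {x n} but not the pair {x n, x (j n)} of V n; the
   points x i with i < n are excluded so that it contains no other such pair. *)
have [||n Vn] := VW (\bigcup_n (hit (H n.+1) `&` miss (x @` `I_n)
    `&` miss [set x (j n)])).
- apply: bigcup_open => n _; apply: openI; last exact/open_miss/compact_set1.
  by apply: openI; [exact: open_hit|exact: open_miss].
- move=> p [/sAP[n ->] _]; exists n => //; split; first split.
  + by exists (x n); split; [left|apply/Hx].
  + rewrite /miss /= => y yx [i /= lin xi].
    have /Hx := lin; rewrite xi; have -> : y = x n by case: yx.
    by move=> /Hx; rewrite ltnn.
  + rewrite /miss /= => y yx yj.
    have [jn _] := jP n; have /Hx := jn.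
    have -> : x n = x (j n) by rewrite -yj; case: yx.
    by move=> /Hx; rewrite ltnn.
- have [jn Vnj] := jP n.
  have [//|i _ [[hiti missi] missj]] := Vn (pair_CL T1 (x n) (x (j n))).
  (* Meeting H i.+1 forces n <= i, and avoiding x 0, ..., x i.-1 forces n = i,
     but then x (j n) should be avoided. *)
  have ni : (n <= i)%N.
    have [y [[|] /= -> /Hx]] := hiti; first by rewrite ltnS.
    by rewrite ltnS; apply: leq_trans; exact: ltnW.
  have nlt : ~ (n < i)%N.
    by move=> lt_ni; apply: (missi (x n)); [left|exists n].
  have ein : n = i by apply/eqP; rewrite eqn_leq ni leqNgt; apply/negP.
  by apply: (missj (x (j n))); [right|rewrite -ein].
Qed.

(** The V n are a countable base at the set of singletons; the sets that do not
    contain both x and y form an open set that contains all singletons. *)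
Lemma D1_within_diagonal {X : topologicalType}
    (T1 : accessible_space X) (F : set (CL X)) :
  hausdorff_space X -> (forall x y, F (pair_CL T1 x y)) -> D1_within F ->
  exists V : nat -> set (CL X),
    [/\ forall n, open (V n), forall n x, V n (pair_CL T1 x x) &
        forall x y, (forall n, V n (pair_CL T1 x y)) -> x = y].
Proof.
move=> hX Fpair D1F.
have [V [oV AV VW]] := D1F (Ffam 1) (Ffam_closed 1 hX).
exists V; split=> // [n x|x y Vxy].
  by apply: AV; split => //; apply/(Ffam1P T1); exists x.
apply: contrapT => nxy.
have [||n Vn] := VW (miss [set x] `|` miss [set y]).
- by apply: openU; apply: open_miss; exact: compact_set1.
- move=> p [/(Ffam1P T1)[z ->] _]; have [zx|zx] := pselect (z = x).
    by right=> t [->|->] /= zy; apply: nxy; rewrite -zx.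
  by left=> t [->|->].
- have [//|xy|xy] := Vn (pair_CL T1 x y).
    by apply: (xy x) => //; left.
  by apply: (xy y) => //; right.
Qed.

Lemma diagonal_compact {X : topologicalType} (T1 : accessible_space X)
    (V : nat -> set (CL X)) :
  (forall n, open (V n)) -> (forall n x, V n (pair_CL T1 x x)) ->
  (forall x y, (forall n, V n (pair_CL T1 x y)) -> x = y) ->
  countably_compact_space X -> compact [set: X].
Proof.
move=> oV Vd Vs cX.
have [X0|/set0P[x _]] := eqVneq [set: X] set0.
  by rewrite X0; exact: compact0.
have [K KP] : {K : nat -> set X & forall n, compact (K n) /\
    forall y, ~ K n y -> V n (pair_CL T1 x y)}.
  apply: (@choice _ _ (fun n K => compact K /\
    forall y, ~ K y -> V n (pair_CL T1 x y))) => n.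
  by have [K ? ?] := pair_CL_cocompact T1 x (V n) (oV n) (Vd n x); exists K.
apply: (@sigma_countably_compact _ (fun n => K n `|` [set x])) cX.
  by move=> n; apply: compactU; [have [] := KP n|exact: compact_set1].
rewrite -subTset => y _; apply: contrapT => ny; apply: ny.
have [xy|xy] := pselect (x = y); first by exists 0 => //; right.
have /existsNP[n nV] : ~ forall n, V n (pair_CL T1 x y) by move=> /Vs.
exists n => //; left; apply: contrapT => nK; apply: nV.
by have [_] := KP n; apply.
Qed.

(** * Second countability *)

Lemma subbase_second_countable {T : topologicalType} (C : set (set T)) :
  countable C -> C `<=` open ->
  (forall x A, nbhs x A -> exists S, [/\ finI_from C id S, S x & S `<=` A]) ->
  @second_countable T.
Proof.
move=> cC oC CA; exists (finI_from C id); first exact: finI_from_countable.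
split=> [S [fs fsC <-]|x A /CA[S [CS Sx SA]]]; last by exists S.
rewrite bigcap_fset big_seq; apply: big_ind => [||S' /fsC/set_mem/oC//].
  exact: openT.
exact: openI.
Qed.

(** For each n, X has a finite cover by open sets with the pairs of points of
    their closures in V n.  If U n is a member of the n-th cover that contains
    x, the intersection of the closures of the U n is {x}; by compactness, the intersection of
    finitely many U n lies in a given neighborhood of x. *)
Lemma diagonal_second_countable {X : topologicalType}
    (T1 : accessible_space X) (V : nat -> set (CL X)) :
  regular_space X -> compact [set: X] ->
  (forall n, open (V n)) -> (forall n x, V n (pair_CL T1 x x)) ->
  (forall x y, (forall n, V n (pair_CL T1 x y)) -> x = y) ->
  @second_countable X.
Proof.
move=> rX cX oV Vd Vs; have hX := regular_T1_hausdorff rX T1.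
pose small n : set (set X) := [set U | open U /\
  forall y z, closure U y -> closure U z -> V n (pair_CL T1 y z)].
have [D DP] : {D : nat -> {fset set X} & forall n, {subset D n <= small n} /\
    [set: X] `<=` \bigcup_(U in [set` D n]) U}.
  apply: (@choice _ _ (fun n D => {subset D <= small n} /\
    [set: X] `<=` \bigcup_(U in [set` D]) U)) => n.
  have [|D ? ?] := compact_fset_cover (small n) cX; last by exists D.
  move=> x _.
  have [U /rX[W xW WU] UV] := pair_CL_near T1 x (V n) hX (oV n) (Vd n x).
  exists (interior W); last exact: nbhs_interior.
  split; first exact: open_interior.
  have WU' : closure (interior W) `<=` U.
    exact: subset_trans (closureS (@interior_subset _ W)) WU.
  by move=> y z /WU' Uy /WU' Uz; exact: UV.
apply: (subbase_second_countable (\bigcup_n [set` D n])).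
- by apply: bigcup_countable => // n _; exact: finite_set_countable.
- by move=> U [n _ /= UD]; have [/(_ _ UD)/set_mem[]] := DP n.
move=> x A xA.
have [U UP] : {U : nat -> set X & forall n, U n \in D n /\ U n x}.
  apply: (@choice _ _ (fun n U => U \in D n /\ U x)) => n.
  by have [_ /(_ x I)[U /= ? ?]] := DP n; exists U.
pose W N := \bigcap_(n in `I_N) U n.
have WS N : W N.+1 = W N `&` U N.
  by rewrite /W eqEsubset; split=> y; [move=> Wy; split=> [n /= nN|];
    apply: Wy => //=; rewrite ltnS // ltnW|move=> [Wy Uy] n /=;
    rewrite ltnS leq_eqVlt => /orP[/eqP->//|]; exact: Wy].
have Wle m n : (m <= n)%N -> W n `<=` W m.
  by move=> mn y Wy i /= im; apply: Wy; exact: leq_trans mn.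
have cA : compact (~` interior A).
  apply: subclosed_compact cX _ => //.
  exact/open_closedC/open_interior.
have [|||B [N BN] AB] := compact_ideal_cover
    [set B | exists N, B `&` W N = set0] cA.
- by exists 0; rewrite set0I.
- move=> B C [m Bm] [n Cn]; exists (maxn m n); rewrite -subset0 => y [BCy Wy].
  have Wm : W m y by apply: Wle Wy; exact: leq_maxl.
  have Wn : W n y by apply: Wle Wy; exact: leq_maxr.
  by case: BCy => ?; [rewrite -Bm|rewrite -Cn].
- move=> y nAy.
  have /existsNP[n nV] : ~ forall n, V n (pair_CL T1 x y).
    by move=> /Vs xy; apply: nAy; rewrite -xy; exact: xA.
  have [UD Ux] := UP n.
  exists (~` closure (U n)).
    exists n.+1; rewrite WS -subset0 => z [nz [_ Uz]].
    exact/nz/subset_closure.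
  apply: open_nbhs_nbhs; split; first exact/closed_openC/closed_closure.
  move=> Uy; apply: nV; have [/(_ _ UD)/set_mem[_ small_U] _] := DP n.
  by apply: small_U => //; exact: subset_closure.
exists (W N); split.
- elim: N {BN} => [|N IH].
    exists fset0 => //; rewrite /W eqEsubset; split=> y // _ i //.
  rewrite WS; apply: finI_fromI => //.
  by apply: finI_from1; exists N => //; have [] := UP N.
- by move=> n _; have [] := UP n.
- move=> y Wy; apply: contrapT => nAy.
  have : (B `&` W N) y by split => //; apply: AB => /interior_subset.
  by rewrite BN.
Qed.

(** The unions of finitely many members of B. *)
Definition finU_from {T : choiceType} (B : set (set T)) : set (set T) :=
  [set \bigcup_(U in [set` D]) U |
     D in [set D : {fset set T} | {subset D <= B}]].

Lemma finU_from_countable {T : choiceType} (B : set (set T)) :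
  countable B -> countable (finU_from B).
Proof.
move=> cB; apply: card_le_trans (card_image_le _ _) _.
exact: fset_subset_countable.
Qed.

Lemma finU_from_open {T : topologicalType} (B : set (set T)) :
  B `<=` open -> finU_from B `<=` open.
Proof.
move=> oB _ [D DB <-]; apply: bigcup_open => U UD; apply: oB.
exact/set_mem/DB.
Qed.

Lemma basis_compact_nbhs {T : topologicalType} (B : set (set T)) (K O : set T) :
  basis B -> compact K -> open O -> K `<=` O ->
  exists2 U, finU_from B U & K `<=` U /\ U `<=` O.
Proof.
move=> [oB Bx] cK oO KO.
have [|D DB KD] := compact_fset_cover [set U | B U /\ U `<=` O] cK.
  move=> x /KO Ox; have [|U [BU Ux] UO] := Bx x O; first exact: open_nbhs_nbhs.
  by exists U => //; apply: open_nbhs_nbhs; split=> //; exact: oB.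
exists (\bigcup_(U in [set` D]) U).
  by exists D => // U /DB/set_mem[BU _]; exact/mem_set.
by split=> // x [U /DB/set_mem[_ UO]]; exact: UO.
Qed.

Lemma compact_second_countable_D1 {Y : topologicalType} :
  compact [set: Y] -> @second_countable Y -> D1_space Y.
Proof.
move=> cY [B cB basB] A cA.
have cptA : compact A by exact: subclosed_compact cA cY _.
exists (finU_from B `&` [set U | A `<=` U]); split.
- apply: sub_countable (subset_card_le _) (finU_from_countable B cB).
  exact: subIsetl.
- by move=> U [BU AU]; split=> //; apply: finU_from_open BU; have [] := basB.
- move=> V oV AV.
  by have [U BU [AU UV]] := basis_compact_nbhs B A V basB cptA oV AV; exists U.
Qed.

(** An ultrafilter F on CL X converges to the set L of the points x such that
    F contains hit U for every open neighborhood U of x; the compactness of X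
    serves only to show that L is nonempty. *)
Lemma CL_compact {X : topologicalType} :
  compact [set: X] -> compact [set: CL X].
Proof.
move=> cX; rewrite compact_ultra => F UF _.
pose L := [set x : X | forall U, open U -> U x -> F (hit U)].
have missE (K : set X) : ~` hit K = miss K.
  rewrite eqEsubset; split=> H.
    by move=> nH x Hx Kx; apply: nH; exists x.
  by move=> HK [x [/HK]].
have nL x : ~ L x -> exists2 U, F (miss U) & nbhs x U.
  move=> /existsNP[U /not_implyP[oU /not_implyP[Ux nF]]].
  exists U; last exact: open_nbhs_nbhs.
  by have [//|] := in_ultra_setVsetC (hit U) UF; rewrite missE.
have missL (K : set X) : compact K -> K `<=` ~` L -> F (miss K).
  move=> cK KL.
  have [|||U FU KU] := compact_ideal_cover [set U : set X | F (miss U)] cK.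
  - by apply: (@filterS _ F _ setT) => [H _ x _ []|]; exact: filterT.
  - move=> U V /= FU FV; apply: filterS (filterI FU FV) => H [HU HV] x Hx.
    by case=> [/(HU x Hx)|/(HV x Hx)].
  - by move=> x /KL /nL.
  - by apply: (@filterS _ F _ (miss U)) FU => H HU x Hx /KU; exact: HU.
have cL : closed L.
  move=> x Lx U oU Ux; have [|y [Ly Uy]] := Lx U; first exact: open_nbhs_nbhs.
  exact: Ly.
have L0 : L !=set0.
  apply: contrapT => L0.
  have [|H HT] := @filter_ex _ F _ (miss setT) (missL setT cX _).
    by move=> x _ Lx; apply: L0; exists x.
  by have [_ [x Hx]] := set_valP H; exact: HT x Hx I.
have LCL : L \in [set A : set X | closed A /\ A !=set0] by exact/mem_set.
exists (SigSub LCL); split=> //=; apply: Fell_cvg.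
- by move=> U oU [x [Lx Ux]]; exact: Lx.
- by move=> K cK LK; apply: missL => // x Kx Lx; exact: LK Lx Kx.
Qed.

(** The sets hit U, with U in a countable base, and miss (~` U), with U a finite
    union of members of this base, generate the Fell topology. *)
Lemma CL_second_countable {X : topologicalType} : hausdorff_space X ->
  compact [set: X] -> @second_countable X -> @second_countable (CL X).
Proof.
move=> hX cX [B cB basB]; have [oB Bx] := basB.
pose C : set (set (CL X)) :=
  (@hit X @` B) `|` ((fun U => miss (~` U)) @` finU_from B).
have cptC (U : set X) : open U -> compact (~` U).
  by move=> oU; apply: subclosed_compact cX _ => //; exact: open_closedC.
apply: (subbase_second_countable C).
- rewrite /C -bigcup2E; apply: bigcup_countable => // -[|[|n]] _ /=.
  + exact: card_le_trans (card_image_le _ _) cB.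
  + exact: card_le_trans (card_image_le _ _) (finU_from_countable B cB).
  + exact: countable0.
- move=> _ [[U /oB oU <-]|[U BU <-]]; first exact: open_hit.
  by apply/open_miss/cptC; exact: finU_from_open BU.
move=> H A HA.
pose F := filter_from (fun S : set (CL X) => finI_from C id S /\ S H) id.
have FF : Filter F.
  apply: filter_from_filter.
    by exists setT; split => //; exists fset0 => //; rewrite eqEsubset; split.
  move=> S S' [CS SH] [CS' SH']; exists (S `&` S') => //; split => //.
  exact: finI_fromI.
have [S [CS SH] SA] : F A.
  apply: (Fell_cvg F H) HA => [U oU [x [Hx Ux]]|K cK HK].
    have [|V [BV Vx] VU] := Bx x U; first exact: open_nbhs_nbhs.
    exists (hit V).
      by split; [apply: finI_from1; left; exists V|exists x].
    by move=> H' [y [? Vy]]; exists y; split=> //; exact: VU.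
  have oK : open (~` K) by apply: closed_openC; exact: compact_closed.
  have cptH : compact (cl_set H).
    by apply: subclosed_compact cX _ => //; have [] := set_valP H.
  have [U BU [HU UK]] := basis_compact_nbhs B _ _ basB cptH oK HK.
  exists (miss (~` U)).
    split; first by apply: finI_from1; right; exists U.
    by move=> x /HU Ux; exact.
  move=> H' H'U x H'x Kx; apply: (H'U x H'x) => /UK; exact.
by exists S.
Qed.

(** * Metrizability *)

Lemma basis_enum {X : topologicalType} (B : set (set X)) :
  countable B -> exists b : nat -> set X, B `<=` range b.
Proof.
move=> /pfcard_geP[->|[f]]; first by exists (fun=> set0).
by exists f => U /(@surj _ _ _ _ f)[n _ <-]; exists n.
Qed.

(** The functions come from Urysohn's lemma, applied to the closure of U and to
    the complement of V, for U and V in a countable base; only the pairs such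
    that the closure of U is contained in V matter. *)
Lemma normal_separating_family (R : realType) {X : topologicalType} :
  regular_space X -> normal_space X -> @second_countable X ->
  exists f : nat -> X -> R,
    [/\ forall k, continuous (f k),
        forall k x, (0 <= f k x <= 1)%R &
        forall x O, open O -> O x ->
          exists k, f k x = 0%R /\ forall y, ~ O y -> f k y = 1%R].
Proof.
move=> rX nX [B cB [oB Bx]].
have [b Bb] := basis_enum B cB.
pose g (p : nat * nat) : X -> R := Urysohn (closure (b p.1)) (~` b p.2).
(* The pairs (i, j) are coded by natural numbers. *)
exists (fun k =>
  if @choice.unpickle (nat * nat)%type k is Some p then g p else cst 0%R).
split.
- move=> k; case: choice.unpickle => [p|]; last by move=> x; exact: cvg_cst.
  exact: Urysohn_continuous.
- move=> k x; case: choice.unpickle => [p|]; last by rewrite /= lexx ler01.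
  have : (g p @` setT) (g p x) by exists x.
  by move/Urysohn_range; rewrite /= in_itv.
move=> x O oO Ox.
have [|V [BV Vx] VO] := Bx x O; first exact: open_nbhs_nbhs.
have [|W xW WV] := rX x V.
  by apply: open_nbhs_nbhs; split=> //; exact: oB.
have [U [BU Ux] UW] := Bx x W xW.
have [i _ iU] := Bb U BU; have [j _ jV] := Bb V BV.
have sep : uniform_separator (closure U) (~` V).
  have := (@normal_separatorP R X).1 nX; apply.
  - exact: closed_closure.
  - exact/open_closedC/oB.
  - apply/disjoints_subset; rewrite setCK.
    exact: subset_trans (closureS UW) WV.
exists (choice.pickle (i, j)); rewrite choice.pickleK /g /= iU jV; split.
  by apply: (Urysohn_sub0 sep); exists x => //; exact: subset_closure.
by move=> y nOy; apply: (Urysohn_sub1 sep); exists y => // /VO.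
Qed.

Local Open Scope ring_scope.

(** The metric is the supremum over k of the distance of f k x to f k y, divided
    by k + 1. *)
Lemma separating_family_metrizable (R : realType) {X : topologicalType}
    (f : nat -> X -> R) : accessible_space X ->
  (forall k, continuous (f k)) -> (forall k x, 0 <= f k x <= 1) ->
  (forall x O, open O -> O x ->
     exists k, f k x = 0 /\ forall y, ~ O y -> f k y = 1) ->
  metrizable R X.
Proof.
move=> T1 cf f01 fsep.
pose g k x y : R := k.+1%:R^-1 * `|f k x - f k y|.
have kge0 k : 0 <= k.+1%:R^-1 :> R by rewrite invr_ge0.
have kgt0 k : 0 < k.+1%:R^-1 :> R by rewrite invr_gt0.
have f1 k x y : `|f k x - f k y| <= 1.
  have /andP[x0 x1] := f01 k x; have /andP[y0 y1] := f01 k y.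
  rewrite ler_norml; apply/andP; split; rewrite ?lerBrDr ?lerBlDr.
    by rewrite (le_trans _ x0)// addrC subr_le0.
  by rewrite (le_trans x1)// lerDl.
have g_le k x y : g k x y <= k.+1%:R^-1 by rewrite ler_piMr.
have g_ge0 k x y : 0 <= g k x y by rewrite mulr_ge0.
pose d x y := sup (range (fun k => g k x y)).
have d_ub k x y : g k x y <= d x y.
  apply: ub_le_sup; last by exists k.
  exists 1 => _ [m _ <-]; apply: le_trans (g_le m x y) _.
  by rewrite invf_le1 ?ltr0n// ler1n.
have d_lub x y e : (forall k, g k x y <= e) -> d x y <= e.
  move=> ge; apply: ge_sup; first by exists (g 0%N x y), 0%N.
  by move=> _ [k _ <-].
have dsep x O : open O -> O x -> exists2 e, 0 < e & forall y, d x y < e -> O y.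
  move=> oO Ox; have [k [fx fO]] := fsep x O oO Ox.
  exists k.+1%:R^-1 => // y; apply: contraPP => /fO fy; apply/negP.
  rewrite -leNgt; apply: le_trans (d_ub k x y).
  by rewrite /g fx fy sub0r normrN normr1 mulr1.
have dxx x : d x x = 0.
  apply: le_anti; rewrite (le_trans (g_ge0 0%N x x) (d_ub _ _ _)) andbT.
  by apply: d_lub => k; rewrite /g subrr normr0 mulr0.
exists d.
  split=> [x y|x y|x y|x y z].
  - exact: le_trans (g_ge0 0%N x y) (d_ub _ _ _).
  - split=> [dxy|->//]; apply: contrapT => nxy.
    have [||e e0 de] := dsep x (~` [set y]).
    + exact/closed_openC/accessible_closed_set1.
    + by [].
    + by apply: (de y); rewrite ?dxy.
  - by rewrite /d; congr sup; rewrite eqEsubset; split=> _ [k _ <-];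
      exists k => //; rewrite /g distrC.
  - apply: d_lub => k; apply: le_trans (lerD (d_ub k x y) (d_ub k y z)).
    by rewrite /g -mulrDr ler_wpM2l// ler_distD.
move=> U; split=> [oU x Ux|dU].
  by have [e e0 de] := dsep x U oU Ux; exists e.
rewrite openE => x /dU[e e0 deU].
have e20 : 0 < e / 2 by rewrite divr_gt0.
(* The terms of index at least N are small by their weight, those of index
   less than N are small near x by continuity. *)
have [N] := ltr_add_invr e20; rewrite add0r => Ne.
have : nbhs x [set y | forall k : 'I_N, `|f k x - f k y| < e / 2].
  apply: filter_forall => k.
  by have /cvgrPdist_lt := cf k x; apply.
apply: filterS => y fy; apply: deU => /=.
apply: (@le_lt_trans _ _ (e / 2)); last by rewrite ltr_pdivrMr// ltr_pMr// ltr1n.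
apply: d_lub => k; have [kN|Nk] := ltnP k N.
  apply: le_trans (ltW (fy (Ordinal kN))); rewrite /g /= ler_piMl//.
  by rewrite invf_le1 ?ltr0n// ler1n.
apply: le_trans (g_le k x y) (le_trans _ (ltW Ne)).
by rewrite lef_pV2 ?posrE ?ltr0n// ler_nat.
Qed.

Lemma metrizable_second_countable (R : realType) {X : topologicalType} :
  compact [set: X] -> metrizable R X -> @second_countable X.
Proof.
move=> cX [d [d_ge0 d_eq0 d_sym d_tri] dopen].
pose ball x (e : R) := [set y | d x y < e].
have ball_open x e : open (ball x e).
  apply/dopen => y xy; exists (e - d x y); first by rewrite subr_gt0.
  by move=> z /= yz; apply: le_lt_trans (d_tri x y z) _; rewrite addrC -ltrBrDr.
have ball_nbhs x e : 0 < e -> nbhs x (ball x e).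
  move=> e0; apply: open_nbhs_nbhs; split => //.
  by rewrite /ball /= (d_eq0 x x).2.
have [D DP] : {D : nat -> {fset set X} & forall n,
    {subset D n <= range (fun x => ball x n.+1%:R^-1)} /\
    [set: X] `<=` \bigcup_(U in [set` D n]) U}.
  apply: (@choice _ _ (fun n D =>
    {subset D <= range (fun x => ball x n.+1%:R^-1)} /\
    [set: X] `<=` \bigcup_(U in [set` D]) U)) => n.
  have [|D ? ?] := compact_fset_cover (range (fun x => ball x n.+1%:R^-1)) cX.
    move=> x _; exists (ball x n.+1%:R^-1); first by exists x.
    by apply: ball_nbhs; rewrite invr_gt0.
  by exists D.
exists (\bigcup_n [set` D n]).
  by apply: bigcup_countable => // n _; exact: finite_set_countable.
split=> [U [n _ /= UD]|x A].
  by have [/(_ _ UD)/set_mem[x _ <-]] := DP n.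
rewrite nbhsE => -[Q [oQ Qx] QA].
have [e e0 eQ] := (dopen Q).1 oQ x Qx.
have e20 : 0 < e / 2 by rewrite divr_gt0.
have [N] := ltr_add_invr e20; rewrite add0r => Ne.
have [DN /(_ x I)[U /= UD Ux]] := DP N.
exists U; first by split=> //; exists N.
have /set_mem[c _ cU] := DN _ UD.
move: Ux; rewrite -cU /ball /= => cx z cz; apply/QA/eQ => /=.
apply: le_lt_trans (d_tri x c z) _.
rewrite d_sym (splitr e); apply: ltrD; exact: lt_trans Ne.
Qed.

Local Close Scope ring_scope.

(** * The equivalences *)

Lemma D1_within_compact_metrizable (R : realType) {X : topologicalType}
    (T1 : accessible_space X) (F : set (CL X)) :
  regular_space X -> (forall x y, F (pair_CL T1 x y)) -> D1_within F ->
  compact [set: X] /\ metrizable R X.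
Proof.
move=> rX Fpair D1F; have hX := regular_T1_hausdorff rX T1.
have [V [oV Vd Vs]] := D1_within_diagonal T1 F hX Fpair D1F.
have cX : compact [set: X].
  apply: (diagonal_compact T1 V oV Vd Vs).
  exact: (D1_within_countably_compact T1 F hX Fpair D1F).
have scX := diagonal_second_countable T1 V rX cX oV Vd Vs.
split=> //.
have [f [cf f01 fsep]] :=
  normal_separating_family R rX (compact_normal hX cX) scX.
exact: (separating_family_metrizable R f T1 cf f01 fsep).
Qed.

Lemma compact_metrizable_D1_CL (R : realType) {X : topologicalType} :
  hausdorff_space X -> compact [set: X] -> metrizable R X -> D1_space (CL X).
Proof.
move=> hX cX mX; apply: compact_second_countable_D1; first exact: CL_compact.
by apply: CL_second_countable => //; exact: (metrizable_second_countable R).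
Qed.

Lemma pair_CL_Ffam {X : topologicalType} (T1 : accessible_space X) (n : nat)
    (x y : X) : (2 <= n)%N -> Ffam n (pair_CL T1 x y).
Proof.
move=> n2; apply: contrapT => /card_le_IINP[D Dn Dxy].
have /fsubset_leq_card : (D `<=` [fset x; y])%fset.
  by apply/fsubsetP => z /Dxy[->|->]; rewrite !inE eqxx ?orbT.
rewrite Dn cardfs2 => /(leq_trans n2).
by case: (x != y).
Qed.

Theorem theorem2p6 (R : realType) (X : topologicalType)
  (X_regular : regular_space X) (X_T1 : accessible_space X) :
  [<-> D1_space (CL X);
       D1_space (set_type (@Kfam X));
       exists2 n : nat, (2 <= n)%N & D1_space (set_type (@Ffam X n));
       compact [set: X] /\ metrizable R X].
Proof.
have hX := regular_T1_hausdorff X_regular X_T1.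
have D1_CM := @D1_within_compact_metrizable R X X_T1.
have CM_CL : compact [set: X] /\ metrizable R X -> D1_space (CL X).
  by move=> [cX mX]; exact: compact_metrizable_D1_CL mX.
have CM_F n : compact [set: X] /\ metrizable R X ->
    D1_space (set_type (@Ffam X n)).
  by move=> /CM_CL; apply: D1_space_closed; exact: Ffam_closed.
tfae.
- move=> /D1_space_withinT /(D1_CM setT X_regular)[//|cX mX].
  apply: D1_space_closed (CM_CL _) => //.
  rewrite (_ : Kfam (X := X) = setT); first exact: closedT.
  rewrite -subTset => H _; apply: subclosed_compact cX _ => //.
  by have [] := set_valP H.
- move=> /D1_space_within /(D1_CM _ X_regular) CM; exists 2 => //.
  apply: CM_F; apply: CM => x y; apply: finite_compact.
  by rewrite pair_CLE finite_setU; split; exact: finite_set1.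
- move=> [n n2 /D1_space_within /(D1_CM _ X_regular)]; apply=> x y.
  exact: pair_CL_Ffam.
- exact: CM_CL.
Qed.
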